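(* Let $\xi>0$ be such that the matrix $D^TD-\xi^2I$ is non-singular. For $\omega\ge0$, the matrix $G(j\omega)$ has a singular value equal to $\xi$ if and only if $\lambda=j\omega$ is an eigenvalue of the operator $\mathcal{L}_\xi$.
   Context: Here $j$ is the imaginary unit, $A_0,\dots,A_m\in\mathbb{R}^{n\times n}$, $B\in\mathbb{R}^{n\times n_u}$, $C\in\mathbb{R}^{n_y\times n}$, $D\in\mathbb{R}^{n_y\times n_u}$, and $\tau_0,\dots,\tau_m\ge0$ with $\max_{0\le i\le m}\tau_i=1$. The transfer function is $$G(j\omega)=C\Big(j\omega I-A_0-\sum_{i=1}^mA_ie^{-j\omega\tau_i}\Big)^{-1}B+De^{-j\omega\tau_0}.$$ Standing assumption (stability of $G$): all zeros $\lambda\in\mathbb{C}$ of $\det(\lambda I-A_0-\sum_{i=1}^mA_ie^{-\lambda\tau_i})=0$ lie in the open left half plane. Put $D_\xi=D^TD-\xi^2I$ and $$M_0=\begin{bmatrix}A_0&-BD_\xi^{-1}B^T\\-C^TC+C^TDD_\xi^{-1}D^TC&-A_0^T\end{bmatrix},\ M_i=\begin{bmatrix}A_i&0\\0&0\end{bmatrix},\ M_{-i}=\begin{bmatrix}0&0\\0&-A_i^T\end{bmatrix}\ (1\le i\le m),$$ $$N_1=\begin{bmatrix}0&0\\0&C^TDD_\xi^{-1}B^T\end{bmatrix},\ N_{-1}=\begin{bmatrix}-BD_\xi^{-1}D^TC&0\\0&0\end{bmatrix}.$$ Let $X=\mathcal{C}([-1,1],\mathbb{C}^{2n})$ be the space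 of continuous functions. The operator $\mathcal{L}_\xi$ on $X$ has domain $$\mathcal{D}(\mathcal{L}_\xi)=\Big\{\phi\in X:\ \phi'\in X,\ \phi'(0)=M_0\phi(0)+\sum_{i=1}^m(M_i\phi(-\tau_i)+M_{-i}\phi(\tau_i))+N_1\phi(-\tau_0)+N_{-1}\phi(\tau_0)\Big\}$$ and acts by $\mathcal{L}_\xi\phi=\phi'$. An eigenvalue of $\mathcal{L}_\xi$ is a $\lambda\in\mathbb{C}$ such that $\mathcal{L}_\xi u=\lambda u$ for some nonzero $u\in\mathcal{D}(\mathcal{L}_\xi)$. *)

(* Defs.v *)
From HB Require Import structures.
From mathcomp Require Import all_boot all_order all_algebra.
From mathcomp Require Import all_classical all_reals all_analysis.
From mathcomp Require Import complex.
Set Implicit Arguments.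
Unset Strict Implicit.
Unset Printing Implicit Defensive.
Import Order.TTheory GRing.Theory Num.Theory.
Import numFieldNormedType.Exports.
Local Open Scope classical_set_scope.
Local Open Scope ring_scope.
Local Open Scope complex_scope.
Local Open Scope sesquilinear_scope.

(* R[i] is only an algebraic structure in mathcomp-real-closed; here it gets
   the topology of its modulus, and hence so do vectors over it. *)
#[warnings="-redundant-canonical-projection"]
HB.instance Definition _ (R : realType) := NormedModule.copy R[i] (R[i]^o).

Definition cexp (R : realType) (z : R[i]) : R[i] :=
  (expR (complex.Re z))%:C * (cos (complex.Im z) +i* sin (complex.Im z)).

Notation cmx A := (map_mx (real_complex _) A).

(* Unit singular vectors on both sides: this gives exactly the min(p, q)
   usual singular values, including for s = 0 and G rectangular. *)
Definition singular_value (R : realType) (p q : nat) (G : 'M[R[i]]_(p, q))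
    (s : R) : Prop :=
  0 <= s /\
  exists (u : 'cV[R[i]]_p) (v : 'cV[R[i]]_q),
    [/\ u^t* *m u = 1%:M, v^t* *m v = 1%:M,
        G *m v = s%:C *: u & G^t* *m u = s%:C *: v].

(* Throughout, A and tau are indexed by 0, ..., m, and the indices 1, ..., m
   are the [lift ord0 i] with [i : 'I_m]; tau_0 is the delay of D. *)
Definition char_mx_delay (R : realType) (m n : nat) (A : 'I_m.+1 -> 'M[R]_n)
    (tau : 'I_m.+1 -> R) (lambda : R[i]) : 'M[R[i]]_n :=
  lambda%:M - cmx (A ord0)
  - \sum_(i < m) cexp (- lambda * (tau (lift ord0 i))%:C)
                 *: cmx (A (lift ord0 i)).

Definition transfer (R : realType) (m n nu ny : nat)
    (A : 'I_m.+1 -> 'M[R]_n) (B : 'M[R]_(n, nu)) (C : 'M[R]_(ny, n))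
    (D : 'M[R]_(ny, nu)) (tau : 'I_m.+1 -> R) (s : R[i]) : 'M[R[i]]_(ny, nu) :=
  cmx C *m invmx (char_mx_delay A tau s) *m cmx B
  + cexp (- s * (tau ord0)%:C) *: cmx D.

Definition stable (R : realType) (m n : nat) (A : 'I_m.+1 -> 'M[R]_n)
    (tau : 'I_m.+1 -> R) : Prop :=
  forall lambda : R[i],
    \det (char_mx_delay A tau lambda) = 0 -> complex.Re lambda < 0.

Definition Dxi (R : realType) (nu ny : nat) (D : 'M[R]_(ny, nu)) (xi : R)
    : 'M[R]_nu :=
  D^T *m D - (xi ^+ 2)%:M.

Definition M0 (R : realType) (n nu ny : nat) (A0 : 'M[R]_n)
    (B : 'M[R]_(n, nu)) (C : 'M[R]_(ny, n)) (D : 'M[R]_(ny, nu)) (xi : R)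
    : 'M[R]_(n + n) :=
  block_mx A0
           (- (B *m invmx (Dxi D xi) *m B^T))
           (- (C^T *m C) + C^T *m D *m invmx (Dxi D xi) *m D^T *m C)
           (- A0^T).

Definition Mpos (R : realType) (n : nat) (Ai : 'M[R]_n) : 'M[R]_(n + n) :=
  block_mx Ai 0 0 0.

Definition Mneg (R : realType) (n : nat) (Ai : 'M[R]_n) : 'M[R]_(n + n) :=
  block_mx 0 0 0 (- Ai^T).

Definition N1 (R : realType) (n nu ny : nat)
    (B : 'M[R]_(n, nu)) (C : 'M[R]_(ny, n)) (D : 'M[R]_(ny, nu)) (xi : R)
    : 'M[R]_(n + n) :=
  block_mx 0 0 0 (C^T *m D *m invmx (Dxi D xi) *m B^T).

Definition Nm1 (R : realType) (n nu ny : nat)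
    (B : 'M[R]_(n, nu)) (C : 'M[R]_(ny, n)) (D : 'M[R]_(ny, nu)) (xi : R)
    : 'M[R]_(n + n) :=
  block_mx (- (B *m invmx (Dxi D xi) *m D^T *m C)) 0 0 0.

(* Elements of C([-1, 1], C^k) are represented by total functions on R of
   which only the values on [-1, 1] matter. *)
Definition cont_itv (R : realType) (k : nat) : set (R -> 'cV[R[i]]_k) :=
  [set phi : R -> 'cV[R[i]]_k | {within `[-1, 1], continuous phi}].

(* Difference quotient of phi at t, as the increment tends to 0 with the
   argument s <> t staying in [-1, 1]: the derivative is one-sided at -1, 1. *)
Definition quotient_at (R : realType) (k : nat) (phi : R -> 'cV[R[i]]_k)
    (t : R) : set_system 'cV[R[i]]_k :=
  ((s - t)^-1)%:C *: (phi s - phi t) @[s --> within `[-1, 1] t^'].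

Definition derivable_itv (R : realType) (k : nat) (phi : R -> 'cV[R[i]]_k)
    : Prop :=
  forall t : R, t \in `[-1, 1] -> cvg (quotient_at phi t).

Definition deriv_itv (R : realType) (k : nat) (phi : R -> 'cV[R[i]]_k)
    : R -> 'cV[R[i]]_k :=
  fun t => lim (quotient_at phi t).

Definition L_dom (R : realType) (m n nu ny : nat)
    (A : 'I_m.+1 -> 'M[R]_n) (B : 'M[R]_(n, nu)) (C : 'M[R]_(ny, n))
    (D : 'M[R]_(ny, nu)) (tau : 'I_m.+1 -> R) (xi : R)
    : set (R -> 'cV[R[i]]_(n + n)) :=
  [set phi | [/\ cont_itv phi, derivable_itv phi, cont_itv (deriv_itv phi) &
    deriv_itv phi 0 =
      cmx (M0 (A ord0) B C D xi) *m phi 0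
      + \sum_(i < m) (cmx (Mpos (A (lift ord0 i))) *m phi (- tau (lift ord0 i))
                      + cmx (Mneg (A (lift ord0 i))) *m phi (tau (lift ord0 i)))
      + cmx (N1 B C D xi) *m phi (- tau ord0)
      + cmx (Nm1 B C D xi) *m phi (tau ord0)]].

(* Equality in C([-1, 1], C^k) is equality on [-1, 1], and u is nonzero when it
   does not vanish identically there. *)
Definition op_eigenvalue (R : realType) (k : nat)
    (dom : set (R -> 'cV[R[i]]_k))
    (L : (R -> 'cV[R[i]]_k) -> (R -> 'cV[R[i]]_k)) (lambda : R[i]) : Prop :=
  exists u : R -> 'cV[R[i]]_k,
    [/\ dom u,
        (exists2 t : R, t \in `[-1, 1] & u t != 0) &
        forall t : R, t \in `[-1, 1] -> L u t = lambda *: u t].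

Definition L_eigenvalue (R : realType) (m n nu ny : nat)
    (A : 'I_m.+1 -> 'M[R]_n) (B : 'M[R]_(n, nu)) (C : 'M[R]_(ny, n))
    (D : 'M[R]_(ny, nu)) (tau : 'I_m.+1 -> R) (xi : R) (lambda : R[i]) : Prop :=
  op_eigenvalue (L_dom A B C D tau xi) (@deriv_itv R (n + n)) lambda.

(* Main.v *)
(* An eigenfunction of L_xi for lambda = j omega solves u' = lambda u on [-1, 1],
   hence u t = e^(lambda t) c with c = (x, z) nonzero, and the boundary condition
   at 0 becomes a linear equation for c.  Write Delta = Delta(lambda) for the
   characteristic matrix, which stability makes invertible on the imaginary
   axis, e = e^(- lambda tau_0), which has modulus 1, and
     v = - D_xi^-1 (B^* z + conj(e) D^* C x).
   Since conj(lambda) = - lambda, the two blocks of this equation read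
     Delta x = B v   and   Delta^* z = C^* (C x + e D v),
   so that G v = C x + e D v and G^* (G v) = xi^2 v, and v = 0 would force c = 0.
   Conversely an eigenvector v of G^* G for xi^2 gives x and z by these two
   equations, and v is then recovered from them by the formula above. *)
Require Import Defs.
From mathcomp Require Import all_boot all_order all_algebra.
From mathcomp Require Import all_classical all_reals all_analysis.
From mathcomp Require Import complex ring lra.
Set Implicit Arguments.
Unset Strict Implicit.
Unset Printing Implicit Defensive.
Import Order.TTheory GRing.Theory Num.Theory.
Import numFieldNormedType.Exports.
Local Open Scope ring_scope.
Local Open Scope complex_scope.

(** * Singular values and the Hamiltonian system *)

Section ConjugateTranspose.
Local Open Scope sesquilinear_scope.
Local Close Scope complex_scope.
Variable K : numClosedFieldType.
Implicit Types (a b c : nat) (e : K).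

Lemma adjmxD a b (M N : 'M[K]_(a, b)) : (M + N)^t* = M^t* + N^t*.
Proof. by rewrite linearD map_mxD. Qed.

Lemma adjmxZ a b e (M : 'M[K]_(a, b)) : (e *: M)^t* = e^* *: M^t*.
Proof. by rewrite linearZ map_mxZ. Qed.

Lemma adjmxM a b c (M : 'M[K]_(a, b)) (N : 'M[K]_(b, c)) :
  (M *m N)^t* = N^t* *m M^t*.
Proof. by rewrite trmx_mul map_mxM. Qed.

Lemma adjmx_inv a (M : 'M[K]_a) : (invmx M)^t* = invmx (M^t*).
Proof. by rewrite trmx_inv map_invmx. Qed.

Lemma adjmx_unit a (M : 'M[K]_a) : (M^t* \in unitmx) = (M \in unitmx).
Proof. by rewrite map_unitmx unitmx_tr. Qed.

Lemma col_dotE a (v : 'cV[K]_a) :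
  v^t* *m v = (\sum_i `|v i 0| ^+ 2)%:M.
Proof.
rewrite [LHS]mx11_scalar mxE; congr (_%:M); apply: eq_bigr => i _.
by rewrite !mxE mulrC -normCK.
Qed.

Lemma col_norm_gt0 a (v : 'cV[K]_a) : v != 0 -> 0 < \sum_i `|v i 0| ^+ 2.
Proof.
move=> v0; rewrite lt_def sumr_ge0 ?andbT => [|i _]; last exact: exprn_ge0.
apply: contra v0 => /eqP/psumr_eq0P H; apply/eqP/colP => i; rewrite mxE.
apply/eqP; rewrite -normr_eq0 -(sqrf_eq0 `|_|); apply/eqP.
by apply: H => // j _; exact: exprn_ge0.
Qed.

Lemma col_unit_neq0 a (v : 'cV[K]_a) : v^t* *m v = 1%:M -> v != 0.
Proof.
apply: contra_eq_neq => ->; rewrite mulmx0 eq_sym.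
by apply/eqP => /matrixP/(_ 0 0)/eqP; rewrite !mxE oner_eq0.
Qed.

(** Since [s] is invertible, the left vector is determined by the right one as [s^-1 *: (G *m v)].
    Its norm is then automatically 1 when [v] is a unit eigenvector of G^* G. *)
Lemma singular_pairP (p q : nat) (G : 'M[K]_(p, q)) (s : K) : 0 < s ->
  (exists (u : 'cV[K]_p) (v : 'cV[K]_q),
     [/\ u^t* *m u = 1%:M, v^t* *m v = 1%:M,
         G *m v = s *: u & G^t* *m u = s *: v]) <->
  exists2 v : 'cV[K]_q, v != 0 & G^t* *m (G *m v) = s ^+ 2 *: v.
Proof.
move=> s0; have sN0 := lt0r_neq0 s0.
split=> [[u [v [_ /col_unit_neq0 v0 Gv Gu]]]|].
  by exists v => //; rewrite Gv -scalemxAr Gu scalerA expr2.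
(* [c] is the Euclidean norm of [v]. Dividing by it normalises [v], and the further factor [s^-1]
   normalises [G *m v]. *)
case=> v /col_norm_gt0 v0 Gv; pose c := sqrtC (\sum_i `|v i 0| ^+ 2).
have c0 : 0 < c by rewrite sqrtC_gt0.
have cN0 := lt0r_neq0 c0.
have cV : c^-1 ^* = c^-1 by apply/CrealP/gtr0_real; rewrite invr_gt0.
have scV : (s^-1 * c^-1)^* = s^-1 * c^-1.
  by apply/CrealP/gtr0_real; rewrite mulr_gt0 ?invr_gt0.
have vN : v^t* *m v = (c ^+ 2)%:M by rewrite col_dotE sqrtCK.
exists ((s^-1 * c^-1) *: (G *m v)), (c^-1 *: v); split.
- rewrite adjmxZ adjmxM -scalemxAl -scalemxAr -mulmxA Gv scalerA scV.
  rewrite -scalemxAr vN scalerA -scalemx1 scalerA -[RHS]scale1r; congr (_ *: _).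
  by field; rewrite ?cN0 ?sN0.
- rewrite adjmxZ -scalemxAl -scalemxAr scalerA cV vN -scalemx1 scalerA.
  by rewrite -[RHS]scale1r; congr (_ *: _); field.
- by rewrite -scalemxAr scalerA mulrA divff ?mul1r.
- by rewrite -scalemxAr Gv !scalerA; congr (_ *: _); field; rewrite cN0 sN0.
Qed.

(** Introducing the states x = Delta^-1 B v and z = Delta^-* C^* G v removes the inverses of [Delta]
    from G^* G v = s^2 v. What remains is linear in v with matrix [W], and solving it gives v =
    [- y x z]. The condition on [e] turns the product of the two feedthrough terms into D^* D. *)
Lemma singular_pencilP (n p q : nat) (Delta : 'M[K]_n) (B : 'M[K]_(n, q))
    (C : 'M[K]_(p, n)) (D : 'M[K]_(p, q)) (e s : K) :
  let W := D^t* *m D - (s ^+ 2)%:M in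
  let G := C *m invmx Delta *m B + e *: D in
  let y (x z : 'cV[K]_n) :=
    invmx W *m (B^t* *m z + e^* *: (D^t* *m (C *m x))) in
  Delta \in unitmx -> W \in unitmx -> e^* * e = 1 ->
  (exists2 v : 'cV[K]_q, v != 0 & G^t* *m (G *m v) = s ^+ 2 *: v) <->
  exists x z : 'cV[K]_n,
    [/\ (x != 0) || (z != 0),
        Delta *m x = - (B *m y x z) &
        Delta^t* *m z = C^t* *m (C *m x - e *: (D *m y x z))].
Proof.
move=> W G y Du Wu e1.
have Du' : Delta^t* \in unitmx by rewrite adjmx_unit.
have GE (x : 'cV_n) (v : 'cV_q) :
    Delta *m x = B *m v -> G *m v = C *m x + e *: (D *m v).
  by move=> xE; rewrite mulmxDl -!mulmxA -xE mulKmx// scalemxAl.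
have GaE (z : 'cV_n) (w : 'cV_p) : Delta^t* *m z = C^t* *m w ->
    G^t* *m w = B^t* *m z + e^* *: (D^t* *m w).
  move=> zE; rewrite adjmxD adjmxZ !adjmxM adjmx_inv mulmxDl -scalemxAl.
  by rewrite -!mulmxA -zE mulKmx.
have WE (v : 'cV_q) : W *m v = D^t* *m (D *m v) - s ^+ 2 *: v.
  by rewrite mulmxBl mulmxA mul_scalar_mx.
split=> [[v v0 Gv]|[x [z [xz0 xE zE]]]].
  pose x := invmx Delta *m (B *m v).
  have xE : Delta *m x = B *m v by rewrite mulKVmx.
  pose z := invmx (Delta^t*) *m (C^t* *m (G *m v)).
  have zE : Delta^t* *m z = C^t* *m (G *m v) by rewrite mulKVmx.
  (* Expanding s^2 v = G^* G v gives B^* z + e^* D^* C x + D^* D v. Subtracting D^* D v leaves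
     [- W *m v] equal to the vector to which [y] applies [invmx W]. *)
  have yE : y x z = - v.
    rewrite -[RHS](mulKmx Wu); congr (_ *m _).
    rewrite mulmxN WE opprB -Gv (GaE _ _ zE).
    rewrite (GE _ _ xE) mulmxDr scalerDr -scalemxAr scalerA e1 scale1r.
    by rewrite addrA addrK.
  exists x, z; split; last 2 first.
  - by rewrite yE xE mulmxN opprK.
  - by rewrite yE mulmxN scalerN opprK zE (GE _ _ xE).
  (* If both states vanish then so does [y x z], which is [- v]. *)
  apply: contraNT v0; rewrite negb_or !negbK => /andP[/eqP x0 /eqP z0].
  by rewrite -oppr_eq0 -yE /y x0 z0 !mulmx0 scaler0 addr0 mulmx0.
pose v := - y x z.
have xE' : Delta *m x = B *m v by rewrite mulmxN.
have wE := GE _ _ xE'.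
have zE' : Delta^t* *m z = C^t* *m (G *m v).
  by rewrite zE wE mulmxN scalerN.
exists v; last first.
  have Wv : W *m v = - (B^t* *m z + e^* *: (D^t* *m (C *m x))).
    by rewrite mulmxN mulKVmx.
  rewrite (GaE _ _ zE') wE mulmxDr scalerDr -scalemxAr scalerA e1 scale1r.
  rewrite addrA -[X in X + _]opprK -Wv WE opprB.
  by rewrite subrK.
(* Conversely v = 0 kills x because [Delta] is invertible, and then z because its adjoint is. *)
apply: contraTneq xz0 => v0; rewrite negb_or !negbK.
have x0 : x = 0 by rewrite -(mulKmx Du x) xE' v0 !mulmx0.
by rewrite x0 eqxx -(mulKmx Du' z) zE' v0 !mulmx0 eqxx.
Qed.
End ConjugateTranspose.

(** * The differential equation on [-1, 1] *)

Section Analysis.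
Local Open Scope classical_set_scope.
Local Open Scope ring_scope.
Local Open Scope complex_scope.

(** * Limits in complex column spaces, reduced to real limits *)

Section ComplexLimits.
Variables (R : realType).

Lemma normc_le_ReIm (z : R[i]) :
  `|z| <= `|complex.Re z|%:C + `|complex.Im z|%:C.
Proof.
rewrite normc_def -rmorphD lecR -(ler_pXn2r (n := 2)) ?nnegrE ?addr_ge0
  ?sqrtr_ge0//.
rewrite sqr_sqrtr ?addr_ge0 ?sqr_ge0// sqrrD !real_normK ?num_real//.
by rewrite lerD2r lerDl mulrn_wge0// mulr_ge0.
Qed.

Lemma normc_ge_Im (z : R[i]) : `|complex.Im z|%:C <= `|z|.
Proof.
rewrite normc_def lecR -(ler_pXn2r (n := 2)) ?nnegrE ?sqrtr_ge0//.
by rewrite sqr_sqrtr ?addr_ge0 ?sqr_ge0// real_normK ?num_real// lerDr sqr_ge0.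
Qed.

Lemma cvg_complexP (T : Type) (F : set_system T) (f : T -> R[i]) (z : R[i]) :
  Filter F ->
  f @ F --> z <->
  (complex.Re (f x) @[x --> F] --> complex.Re z) /\
  (complex.Im (f x) @[x --> F] --> complex.Im z).
Proof.
move=> FF; split=> [/cvgrPdist_lt fz|[/cvgrPdist_lt fr /cvgrPdist_lt fi]].
  split; apply/cvgrPdist_lt => e e0.
    have /fz : (0 : R[i]) < e%:C by rewrite ltcR.
    apply: filterS => x xz; rewrite -ltcR; apply: le_lt_trans xz.
    by rewrite -raddfB; exact: normc_ge_Re.
  have /fz : (0 : R[i]) < e%:C by rewrite ltcR.
  apply: filterS => x xz; rewrite -ltcR; apply: le_lt_trans xz.
  by rewrite -raddfB; exact: normc_ge_Im.
(* Positivity in [R[i]] forces a zero imaginary part, so the radius is a real [e]. Half of it is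
   allotted to each of the two parts. *)
apply/cvgrPdist_lt => -[e e']; rewrite ltcE/= => /andP[/eqP -> e0].
near=> x; apply: le_lt_trans (normc_le_ReIm _) _.
rewrite -rmorphD ltcR (splitr e) !raddfB ltrD//; near: x.
  by apply: fr; rewrite divr_gt0.
by apply: fi; rewrite divr_gt0.
Unshelve. all: by end_near. Qed.

(** Matrix neighbourhoods are generated by products of entry neighbourhoods. There are finitely many
    entries, so a filter that meets each entry condition meets all of them at once. *)
Lemma cvg_colP (T : Type) (F : set_system T) k
    (f : T -> 'cV[R[i]]_k) (l : 'cV[R[i]]_k) :
  Filter F ->
  f @ F --> l <-> forall i, f x i 0 @[x --> F] --> l i 0.
Proof.
move=> FF; split=> [fl i|fl].
  by apply: (cvg_comp f (fun M : 'cV_k => M i 0) fl); exact: coord_continuous.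
move=> A [P lP sPA]; rewrite nbhs_simpl/=.
have : \forall x \near F, forall i, P i 0 (f x i 0).
  by apply: filter_forall => i; exact: (fl i _ (lP i 0)).
by apply: filterS => x Px; apply: sPA => i j; rewrite ord1.
Qed.

Lemma cvg_complex_colP (T : Type) (F : set_system T) k
    (f : T -> 'cV[R[i]]_k) (l : 'cV[R[i]]_k) :
  Filter F ->
  f @ F --> l <-> forall i,
    (complex.Re (f x i 0) @[x --> F] --> complex.Re (l i 0)) /\
    (complex.Im (f x i 0) @[x --> F] --> complex.Im (l i 0)).
Proof.
move=> FF; rewrite cvg_colP.
by split=> H i; apply/cvg_complexP; exact: H.
Qed.

End ComplexLimits.

(** * Difference quotients restricted to [-1, 1] versus ordinary derivatives *)

Section OneSidedQuotients.
Variables (R : realType).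
Implicit Types (f : R -> R) (t l : R).

Let I : set R := [set` `[(-1) : R, 1]].

(** The factor 1 / (s - t) is real, hence commutes with taking real and imaginary parts. *)
Lemma quotient_atP k (phi : R -> 'cV[R[i]]_k) t (l : 'cV[R[i]]_k) :
  quotient_at phi t --> l <-> forall i,
    ((s - t)^-1 * (complex.Re (phi s i 0) - complex.Re (phi t i 0))
       @[s --> within `[-1, 1] t^'] --> complex.Re (l i 0)) /\
    ((s - t)^-1 * (complex.Im (phi s i 0) - complex.Im (phi t i 0))
       @[s --> within `[-1, 1] t^'] --> complex.Im (l i 0)).
Proof.
have ReE i s : complex.Re ((((s - t)^-1)%:C *: (phi s - phi t)) i 0) =
    (s - t)^-1 * (complex.Re (phi s i 0) - complex.Re (phi t i 0)).
  rewrite !mxE; case: (phi s i 0) => a b; case: (phi t i 0) => c d /=.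
  by rewrite mul0r subr0.
have ImE i s : complex.Im ((((s - t)^-1)%:C *: (phi s - phi t)) i 0) =
    (s - t)^-1 * (complex.Im (phi s i 0) - complex.Im (phi t i 0)).
  rewrite !mxE; case: (phi s i 0) => a b; case: (phi t i 0) => c d /=.
  by rewrite mul0r addr0.
rewrite /quotient_at cvg_complex_colP.
by split=> H i; move: (H i); rewrite (funext (ReE i)) (funext (ImE i)).
Qed.

Lemma quotient_is_derive f t l : t \in `](-1), 1[ ->
  (s - t)^-1 * (f s - f t) @[s --> within `[-1, 1] t^'] --> l ->
  is_derive t 1 f l.
Proof.
move=> tI fl; apply/is_derive1_caratheodory.
(* The Carathéodory slope: the difference quotient, extended at [t] by its limit. *)
exists (fun z => if z == t then l else (z - t)^-1 * (f z - f t)).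
split; last by rewrite eqxx.
  move=> z; case: eqVneq => [->|zt]; first by rewrite !subrr mulr0.
  by rewrite mulrC mulrA divff ?mul1r// subr_eq0.
apply/continuous_withinNx; rewrite eqxx.
(* At an interior point the restriction to [-1, 1] holds for all nearby [s], so the restricted limit
   is the full one. *)
have It : \forall s \near t, s \in `](-1), 1[ by exact: near_in_itvoo.
have It' : \forall s \near t^', s \in `](-1), 1[ by exact: cvg_within It.
have tN : \forall s \near t^', s != t by exact: nbhs_dnbhs_neq.
apply: cvg_trans fl => A; rewrite !nbhs_simpl/= => nA.
have {}nA : \forall s \near t^', I s -> A ((s - t)^-1 * (f s - f t)) by [].
apply: filterS3 tN It' nA => s st sI sA.
by rewrite /= (negbTE st); apply: sA; exact: subset_itv_oo_cc.
Qed.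

(** Restricting the increments to [J] keeps the limit, so endpoints of an interval are covered as
    well. *)
Lemma is_derive_quotient f t l (J : set R) : is_derive t 1 f l ->
  (s - t)^-1 * (f s - f t) @[s --> within J t^'] --> l.
Proof.
move=> /is_derive1_caratheodory[g [fg /continuous_withinNx cg <-]].
have tN : \forall s \near t^', s != t by exact: nbhs_dnbhs_neq.
move=> A /cg; rewrite !nbhs_simpl/= => gA.
suff : \forall s \near t^', A ((s - t)^-1 * (f s - f t)) by exact: cvg_within.
apply: filterS2 tN gA => s st.
by rewrite /= fg mulrCA mulVf ?mulr1// subr_eq0.
Qed.

(** The mean value theorem asks for a derivative in the open interval only; continuity carries
    constancy to the endpoints. *)
Lemma derive0_itv_cst f : {within `[-1, 1], continuous f} ->
  (forall t, t \in `](-1), 1[ -> is_derive t 1 f 0) ->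
  forall t, t \in `[(-1), 1] -> f t = f 0.
Proof.
move=> cf df.
have cst a b : -1 <= a -> a <= b -> b <= 1 -> f a = f b.
  move=> a1 ab b1.
  have df' x : x \in `]a, b[ -> is_derive x 1 f ((fun=> 0) x).
    rewrite in_itv/= => /andP[ax xb]; apply: df.
    by rewrite in_itv/= (le_lt_trans a1 ax) (lt_le_trans xb b1).
  have cf' : {within `[a, b], continuous f}.
    apply: continuous_subspaceW cf => x /=; rewrite !in_itv/= => /andP[ax xb].
    by rewrite (le_trans a1 ax) (le_trans xb b1).
  have [_ _] := MVT_segment ab df' cf'.
  by rewrite mul0r => /eqP; rewrite subr_eq0 => /eqP.
move=> t; rewrite in_itv/= => /andP[t1 t2].
by have [t0|/ltW t0] := leP t 0; [|symmetry]; apply: cst.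
Qed.

End OneSidedQuotients.

(** * The equation u' = i w u: exponential solutions and their uniqueness *)

Section ODE.
Variables (R : realType).
Implicit Types (f : R -> R) (s t l w : R).

Lemma cexp_imag w t :
  cexp ((0 +i* w) * t%:C) = cos (w * t) +i* sin (w * t).
Proof.
by rewrite /cexp /= !mul0r !mulr0 subr0 add0r expR0 mul1r.
Qed.

(** Every point of [-1, 1], endpoints included, is a limit of other points of the interval. This
    makes the limit defining [deriv_itv] unique. *)
Lemma proper_quotient t : t \in `[(-1), 1] ->
  ProperFilter (within [set` `[(-1), 1]] t^').
Proof.
rewrite in_itv/= => /andP[t1 t2]; split; last exact: within_filter.
rewrite /within/= /dnbhs near_withinE => /nbhs_ballP[e /= e0 be].
(* A step of size [d] towards the opposite half of the interval stays within distance [e] of [t],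
   and [d <= 1 / 2] keeps it inside [-1, 1]. *)
pose d := Num.min (e / 2) (1 / 2).
have d0 : 0 < d by rewrite lt_min; apply/andP; split; lra.
have de : d <= e / 2 by rewrite ge_min lexx.
have d1 : d <= 1 / 2 by rewrite ge_min lexx orbT.
have [tl|tg] := ltP t 0.
  apply: (be (t + d)).
  - rewrite /ball/= opprD addNKr normrN gtr0_norm//; lra.
  - by rewrite -subr_eq0 addrAC subrr add0r gt_eqF.
  - rewrite /= in_itv/=; apply/andP; split; lra.
apply: (be (t - d)).
- rewrite /ball/= opprD opprK addNKr gtr0_norm//; lra.
- by rewrite -subr_eq0 addrAC subrr add0r oppr_eq0 gt_eqF.
- rewrite /= in_itv/=; apply/andP; split; lra.
Qed.

Lemma derivable_cvg f t : derivable f t 1 -> f s @[s --> t] --> f t.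
Proof. by move=> /derivable1_diffP/differentiable_continuous. Qed.

Section Exponential.
Variables (k : nat) (w : R) (c : 'cV[R[i]]_k).

Let v s := cexp ((0 +i* w) * s%:C) *: c.

Lemma is_derive_Re_exp i t :
  is_derive t 1 (fun s => complex.Re (v s i 0))
            (complex.Re (((0 +i* w) *: v t) i 0)).
Proof.
have -> : (fun s => complex.Re (v s i 0)) = (fun s =>
    cos (w * s) * complex.Re (c i 0) - sin (w * s) * complex.Im (c i 0)).
  by apply/funext => s; rewrite /v cexp_imag mxE; case: (c i 0).
apply: is_derive_eq; rewrite /v cexp_imag !mxE; case: (c i 0) => p q /=.
by rewrite /GRing.scale/=; ring.
Qed.

Lemma is_derive_Im_exp i t :
  is_derive t 1 (fun s => complex.Im (v s i 0))
            (complex.Im (((0 +i* w) *: v t) i 0)).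
Proof.
have -> : (fun s => complex.Im (v s i 0)) = (fun s =>
    cos (w * s) * complex.Im (c i 0) + sin (w * s) * complex.Re (c i 0)).
  by apply/funext => s; rewrite /v cexp_imag mxE; case: (c i 0).
apply: is_derive_eq; rewrite /v cexp_imag !mxE; case: (c i 0) => p q /=.
by rewrite /GRing.scale/=; ring.
Qed.

Lemma quotient_exp t : quotient_at v t --> (0 +i* w) *: v t.
Proof.
apply/quotient_atP => i; split.
  by apply: is_derive_quotient (is_derive_Re_exp i t).
by apply: is_derive_quotient (is_derive_Im_exp i t).
Qed.

Lemma cont_exp : cont_itv v.
Proof.
apply: continuous_subspaceT => t; apply/cvg_complex_colP => i; split.
  by apply: (@derivable_cvg (fun s => complex.Re (v s i 0)));
    have [] := is_derive_Re_exp i t.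
by apply: (@derivable_cvg (fun s => complex.Im (v s i 0)));
  have [] := is_derive_Im_exp i t.
Qed.

End Exponential.

(** Each entry of e^(- i w t) u(t) has zero derivative in the interior, hence is constant on
    [-1, 1]. *)
Lemma ode_unique k w (u : R -> 'cV[R[i]]_k) : cont_itv u ->
  (forall t, t \in `[(-1), 1] -> quotient_at u t --> (0 +i* w) *: u t) ->
  forall t, t \in `[(-1), 1] -> u t = cexp ((0 +i* w) * t%:C) *: u 0.
Proof.
move=> cu du t tI; apply/colP => i.
pose a s := complex.Re (u s i 0); pose b s := complex.Im (u s i 0).
have [ca cb] :
    {within `[-1, 1], continuous a} /\ {within `[-1, 1], continuous b}.
  by split=> s; have /cvg_complex_colP/(_ i)[] := cu s.
have da s : s \in `](-1), 1[ -> is_derive s 1 a (- (w * b s)).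
  move=> sI; have /du/quotient_atP/(_ i)[+ _] := subset_itv_oo_cc sI.
  move=> /(quotient_is_derive sI) ds; apply: is_derive_eq.
  by rewrite !mxE /b; case: (u s i 0) => p q /=; rewrite mul0r sub0r.
have db s : s \in `](-1), 1[ -> is_derive s 1 b (w * a s).
  move=> sI; have /du/quotient_atP/(_ i)[_] := subset_itv_oo_cc sI.
  move=> /(quotient_is_derive sI) ds; apply: is_derive_eq.
  by rewrite !mxE /a; case: (u s i 0) => p q /=; rewrite mul0r add0r.
have ct (f : R -> R) : (forall s, derivable f s 1) ->
    {within `[-1, 1], continuous f}.
  move=> df; apply: continuous_subspaceT => s.
  exact: derivable_cvg.
have cc : {within `[-1, 1], continuous (fun s => cos (w * s))} by exact: ct.
have cs : {within `[-1, 1], continuous (fun s => sin (w * s))} by exact: ct.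
(* [g] and [h] are the real and imaginary parts of e^(- i w s) (a + i b). *)
pose g s := cos (w * s) * a s + sin (w * s) * b s.
pose h s := cos (w * s) * b s - sin (w * s) * a s.
have gt : g t = g 0.
  apply: derive0_itv_cst => // [s|s sI].
    by apply: cvgD; apply: cvgM; [exact: cc|exact: ca|exact: cs|exact: cb].
  have ? := da _ sI; have ? := db _ sI.
  by apply: is_derive_eq; rewrite /GRing.scale/=; ring.
have ht : h t = h 0.
  apply: derive0_itv_cst => // [s|s sI].
    by apply: cvgB; apply: cvgM; [exact: cc|exact: cb|exact: cs|exact: ca].
  have ? := da _ sI; have ? := db _ sI.
  by apply: is_derive_eq; rewrite /GRing.scale/=; ring.
(* The rotation is undone with cos^2 + sin^2 = 1, which expresses u(t) through u(0). *)
have := cos2Dsin2 (w * t); move: gt ht.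
rewrite /g /h /a /b cexp_imag mxE mulr0 cos0 sin0.
case: (u t i 0) => p q; case: (u 0 i 0) => p0 q0 /=.
rewrite !mul0r !mul1r addr0 subr0 => <- <- e1.
by apply/eqP; rewrite eq_complex /=; apply/andP; split; apply/eqP;
  rewrite -[LHS]mul1r -e1; ring.
Qed.

End ODE.

End Analysis.

(** * The boundary condition *)

(** This lemma and the next reduce an equivalence of two linear equations to one identity between
    the differences of their sides, which [ring] can check entrywise. *)
Lemma eq_iff_subr (V : zmodType) (a b c d : V) :
  a - b = c - d -> (a = b) <-> (c = d).
Proof.
move=> E; have {}E : (a == b) = (c == d) by rewrite -subr_eq0 E subr_eq0.
by split=> /eqP; [rewrite E | rewrite -E] => /eqP.
Qed.

Lemma eq_iff_oppr (V : zmodType) (a b c d : V) :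
  a - b = - (c - d) -> (a = b) <-> (c = d).
Proof.
move=> E; have {}E : (a == b) = (c == d).
  by rewrite -subr_eq0 E oppr_eq0 subr_eq0.
by split=> /eqP; [rewrite E | rewrite -E] => /eqP.
Qed.

Section BoundaryEquation.
Local Open Scope classical_set_scope.
Local Open Scope ring_scope.
Local Open Scope complex_scope.
Local Open Scope sesquilinear_scope.
Variables (R : realType) (m n nu ny : nat).
Variables (A : 'I_m.+1 -> 'M[R]_n) (B : 'M[R]_(n, nu)) (C : 'M[R]_(ny, n))
  (D : 'M[R]_(ny, nu)) (tau : 'I_m.+1 -> R) (xi w : R).

Let lam : R[i] := 0 +i* w.
Let E (t : R) : R[i] := cexp (lam * t%:C).

Lemma cexp_imagN t : cexp (- (0 +i* w) * t%:C) = E (- t).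
Proof. by rewrite /E rmorphN mulrN mulNr. Qed.

Lemma conj_cexp_imag t : Num.conj (E t) = E (- t).
Proof. by rewrite /E !cexp_imag mulrN cosN sinN. Qed.

Lemma cexp_imagM t : E (- t) * E t = 1.
Proof.
rewrite /E !cexp_imag mulrN cosN sinN; apply/eqP; rewrite eq_complex /=.
by apply/andP; split; apply/eqP; rewrite -?(cos2Dsin2 (w * t)); ring.
Qed.

(** The right-hand side of the condition at 0 in [L_dom], term for term, for an arbitrary
    function. *)
Definition boundary_map (c : R -> 'cV[R[i]]_(n + n)) :=
  cmx (M0 (A ord0) B C D xi) *m c 0
      + \sum_(i < m) (cmx (Mpos (A (lift ord0 i))) *m c (- tau (lift ord0 i))
                      + cmx (Mneg (A (lift ord0 i))) *m c (tau (lift ord0 i)))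
      + cmx (N1 B C D xi) *m c (- tau ord0)
      + cmx (Nm1 B C D xi) *m c (tau ord0).

(** The vector [c] is the value of the eigenfunction at 0. The bound on [tau] puts all evaluation
    points in [-1, 1], where the eigenfunction is known to be [E t *: c]. *)
Lemma L_eigenvalueP : (forall i, - 1 <= tau i <= 1) ->
  L_eigenvalue A B C D tau xi lam <->
  exists2 c : 'cV_(n + n), c != 0 & lam *: c = boundary_map (fun t => E t *: c).
Proof.
move=> tauI; have I0 : (0 : R) \in `[(-1), 1] by rewrite in_itv/= lerN10 ler01.
have Itau i : tau i \in `[(-1), 1] by rewrite in_itv/= tauI.
have INtau i : - tau i \in `[(-1), 1].
  by rewrite in_itv/= lerNl opprK lerNl andbC tauI.
split=> [[u [[cu du cdu bu] [t tI ut] Lu]]|[c c0 cE]].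
  have qu s : s \in `[(-1), 1] -> quotient_at u s --> lam *: u s.
    by move=> sI; rewrite -(Lu _ sI); exact: du.
  have uE := ode_unique cu qu.
  (* A solution vanishing at 0 vanishes on the whole interval. *)
  exists (u 0); first by apply: contraNneq ut => u0; rewrite uE// u0 scaler0.
  rewrite -(Lu _ I0) bu /boundary_map -!uE//.
  by under [in RHS]eq_bigr => i _ do rewrite -!uE//.
pose u t := E t *: c.
have dE t : t \in `[(-1), 1] -> deriv_itv u t = lam *: u t.
  move=> tI; have ? := proper_quotient tI.
  have hs : hausdorff_space 'cV[R[i]]_(n + n) :=
    @norm_hausdorff R[i] 'cV[R[i]]_(n + n).
  have := @quotient_exp _ _ w c t.
  by rewrite /deriv_itv /quotient_at => /(cvg_lim hs).
have u0 : u 0 = c by rewrite /u /E cexp_imag mulr0 cos0 sin0 scale1r.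
exists u; split; last by move=> t tI; exact: dE.
  split; first exact: cont_exp.
  - by move=> t tI; apply/cvg_ex; exists (lam *: u t); exact: quotient_exp.
  (* On [-1, 1] the derivative coincides with the exponential of coefficient [lam *: c]. Outside,
     the two may differ, so continuity is transferred within the subspace. *)
  - have := @cont_exp _ _ w (lam *: c).
    apply: subspace_eq_continuous => t tI.
    rewrite inE/= in tI; rewrite -[RHS]/(deriv_itv u t) dE//.
    by rewrite /from_subspace /u !scalerA mulrC.
  - by rewrite dE// [X in lam *: X]u0 cE.
by exists 0; rewrite ?u0.
Qed.

Lemma map_real_adj (p q : nat) (M : 'M[R]_(p, q)) : (cmx M)^t* = cmx M^T.
Proof. by apply/matrixP => i j; rewrite !mxE conj_Creal ?complex_real. Qed.

(** As [lam] is purely imaginary, conjugation changes its sign and turns each delay factor into an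
    advance; the coefficient matrices are real and are only transposed. *)
Lemma char_mx_adj : (char_mx_delay A tau lam)^t* =
  - lam%:M - cmx (A ord0)^T
  - \sum_(i < m) E (tau (lift ord0 i)) *: cmx (A (lift ord0 i))^T.
Proof.
rewrite /char_mx_delay !linearB /= !map_mxB; congr (_ - _ - _).
- rewrite tr_scalar_mx map_scalar_mx -scalemx1 -(scalemx1 n lam) -scaleNr.
  congr (_ *: _); apply/eqP; rewrite eq_complex /=.
  apply/andP; split; apply/eqP => //.
  by rewrite oppr0.
- exact: map_real_adj.
- rewrite linear_sum /= map_mx_sum; apply: eq_bigr => i _.
  by rewrite adjmxZ map_real_adj cexp_imagN conj_cexp_imag opprK.
Qed.

(** The [y] of [singular_pencilP] for e = [E (- tau ord0)], whose conjugate is [E (tau ord0)]. *)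
Let y (x z : 'cV[R[i]]_n) : 'cV_nu := invmx (cmx (Dxi D xi)) *m
  (cmx B^T *m z + E (tau ord0) *: (cmx D^T *m (cmx C *m x))).

Lemma usubmx_block (a b c d : 'M[R]_n) (e : R[i]) (x z : 'cV_n) :
  usubmx (cmx (block_mx a b c d) *m (e *: col_mx x z)) =
  e *: (cmx a *m x + cmx b *m z).
Proof. by rewrite -scalemxAr linearZ /= map_block_mx mul_block_col col_mxKu. Qed.

Lemma dsubmx_block (a b c d : 'M[R]_n) (e : R[i]) (x z : 'cV_n) :
  dsubmx (cmx (block_mx a b c d) *m (e *: col_mx x z)) =
  e *: (cmx c *m x + cmx d *m z).
Proof. by rewrite -scalemxAr linearZ /= map_block_mx mul_block_col col_mxKd. Qed.

(** The upper right block of [M0] and the advanced term of [Nm1] add up to - B y. *)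
Lemma usubmx_boundary_map (x z : 'cV_n) :
  usubmx (boundary_map (fun t => E t *: col_mx x z)) =
  cmx (A ord0) *m x
  + \sum_(i < m) E (- tau (lift ord0 i)) *: (cmx (A (lift ord0 i)) *m x)
  - cmx B *m y x z.
Proof.
have E0 : E 0 = 1 by rewrite /E cexp_imag mulr0 cos0 sin0.
rewrite /boundary_map 3!linearD linear_sum /=.
under eq_bigr => i _.
  rewrite linearD /= 2!usubmx_block map_mx0 !mul0mx !addr0 scaler0 addr0; over.
rewrite 3!usubmx_block E0 map_mx0 !mul0mx !addr0 scaler0 addr0 scale1r.
rewrite 2!map_mxN !map_mxM map_invmx !mulNmx scalerN.
rewrite -!addrA; congr (_ + _); rewrite addrCA; congr (_ + _).
by rewrite -opprD /y mulmxDr -scalemxAr mulmxDr -scalemxAr !mulmxA.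
Qed.

Lemma dsubmx_boundary_map (x z : 'cV_n) :
  dsubmx (boundary_map (fun t => E t *: col_mx x z)) =
  - (cmx (A ord0)^T *m z
     + \sum_(i < m) E (tau (lift ord0 i)) *: (cmx (A (lift ord0 i))^T *m z)
     + cmx C^T *m (cmx C *m x - E (- tau ord0) *: (cmx D *m y x z))).
Proof.
have E0 : E 0 = 1 by rewrite /E cexp_imag mulr0 cos0 sin0.
rewrite /boundary_map 3!linearD linear_sum /=.
under eq_bigr => i _.
  rewrite linearD /= 2!dsubmx_block map_mx0 !mul0mx !add0r scaler0 add0r.
  rewrite map_mxN mulNmx scalerN; over.
rewrite 3!dsubmx_block E0 map_mx0 !mul0mx addr0 scaler0 addr0 scale1r add0r.
rewrite map_mxD 2!map_mxN sumrN !map_mxM map_invmx mulmxDl !mulNmx.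
rewrite mulmxBr -scalemxAr.
(* The factor [E (- tau ord0)] cancels the one in front of D^T C x inside [y]. Hence this part sits
   undelayed in [M0], while the B^T z part keeps its delay and sits in [N1]. *)
have -> : E (- tau ord0) *: (cmx C^T *m (cmx D *m y x z)) =
    cmx C^T *m cmx D *m invmx (cmx (Dxi D xi)) *m cmx D^T *m cmx C *m x
  + E (- tau ord0) *:
    (cmx C^T *m cmx D *m invmx (cmx (Dxi D xi)) *m cmx B^T *m z).
  rewrite /y mulmxDr -scalemxAr mulmxDr -scalemxAr mulmxDr -scalemxAr.
  by rewrite scalerDr scalerA cexp_imagM scale1r addrC !mulmxA.
rewrite !mulmxA; move: (\sum_(i < m) _) => s; move: (_ *: _) => a.
move: (_ *m x) => b; move: (_ *m x) => c; move: (_ *m z) => d.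
by apply/matrixP => i j; rewrite !mxE; ring.
Qed.

Lemma char_mx_mul (x : 'cV_n) : char_mx_delay A tau lam *m x =
  lam *: x - cmx (A ord0) *m x
  - \sum_(i < m) E (- tau (lift ord0 i)) *: (cmx (A (lift ord0 i)) *m x).
Proof.
rewrite /char_mx_delay 2!mulmxBl mul_scalar_mx mulmx_suml; congr (_ - _).
by apply: eq_bigr => i _; rewrite cexp_imagN -scalemxAl.
Qed.

Lemma char_mx_adj_mul (z : 'cV_n) : (char_mx_delay A tau lam)^t* *m z =
  - (lam *: z) - cmx (A ord0)^T *m z
  - \sum_(i < m) E (tau (lift ord0 i)) *: (cmx (A (lift ord0 i))^T *m z).
Proof.
rewrite char_mx_adj 2!mulmxBl mulNmx mul_scalar_mx mulmx_suml; congr (_ - _).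
by apply: eq_bigr => i _; rewrite -scalemxAl.
Qed.

Lemma eq_boundary_mapP (x z : 'cV_n) :
  lam *: col_mx x z = boundary_map (fun t => E t *: col_mx x z) <->
  char_mx_delay A tau lam *m x = - (cmx B *m y x z) /\
  (char_mx_delay A tau lam)^t* *m z =
    cmx C^T *m (cmx C *m x - E (- tau ord0) *: (cmx D *m y x z)).
Proof.
have eq_blocks (c d : 'cV[R[i]]_(n + n)) :
    c = d <-> usubmx c = usubmx d /\ dsubmx c = dsubmx d.
  by split=> [->//|[cu cd]]; rewrite -[c]vsubmxK -[d]vsubmxK cu cd.
rewrite eq_blocks usubmx_boundary_map dsubmx_boundary_map scale_col_mx.
rewrite col_mxKu col_mxKd char_mx_mul char_mx_adj_mul -/(y x z).
have and_iff (P P' Q Q' : Prop) : (P <-> Q) -> (P' <-> Q') ->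
  (P /\ P') <-> (Q /\ Q') by tauto.
(* The upper equation is a mere rearrangement; the lower one also changes sign, because the adjoint
   carries [- lam]. *)
apply: and_iff; [apply: eq_iff_subr | apply: eq_iff_oppr]; rewrite /E.
  move: (lam *: x) (\sum_(i < m) _) (_ *m x) (_ *m y x z) => a b c d.
  by apply/matrixP => i j; rewrite !mxE; ring.
move: (lam *: z) (\sum_(i < m) _) (_ *m z) (_ *m (_ - _)) => a b c d.
by apply/matrixP => i j; rewrite !mxE; ring.
Qed.

End BoundaryEquation.

Theorem theorem2p3 (R : realType) (m n nu ny : nat)
    (A : 'I_m.+1 -> 'M[R]_n) (B : 'M[R]_(n, nu)) (C : 'M[R]_(ny, n))
    (D : 'M[R]_(ny, nu)) (tau : 'I_m.+1 -> R)
    (tau_ge0 : forall i, 0 <= tau i)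
    (tau_max : \big[Num.max/tau ord0]_(i < m.+1) tau i = 1)
    (G_stable : stable A tau)
    (xi : R) (xi_gt0 : 0 < xi) (Dxi_unit : Dxi D xi \in unitmx)
    (omega : R) (omega_ge0 : 0 <= omega) :
  singular_value (transfer A B C D tau (0 +i* omega)) xi <->
  L_eigenvalue A B C D tau xi (0 +i* omega).
Proof.
have tauI i : - 1 <= tau i <= 1.
  rewrite (le_trans _ (tau_ge0 i)) ?lerN10//= -tau_max.
  exact: le_bigmax.
rewrite L_eigenvalueP//; set lam := 0 +i* omega.
pose Delta := char_mx_delay A tau lam.
(* A zero determinant would give [lam] a negative real part by stability, but its real part is 0. *)
have Du : Delta \in unitmx.
  by rewrite unitmxE unitfE; apply/negP => /eqP/G_stable; rewrite ltxx.
pose e := cexp (lam * (- tau ord0)%:C).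
have eC : Num.conj e = cexp (lam * (tau ord0)%:C).
  by rewrite /e conj_cexp_imag opprK.
have e1 : Num.conj e * e = 1 by rewrite eC mulrC cexp_imagM.
(* The complex matrix [W] of the pencil is the image of the real [Dxi], so invertibility carries
   over. *)
have WE : map_mx Num.conj (cmx D)^T *m cmx D - (xi%:C ^+ 2)%:M = cmx (Dxi D xi).
  rewrite map_real_adj /Dxi map_mxB map_mxM map_scalar_mx.
  by congr (_ - _%:M); rewrite [RHS]rmorphXn.
have Wu : map_mx Num.conj (cmx D)^T *m cmx D - (xi%:C ^+ 2)%:M \in unitmx.
  by rewrite WE map_unitmx.
have GE : transfer A B C D tau lam = cmx C *m invmx Delta *m cmx B + e *: cmx D.
  by rewrite /transfer cexp_imagN.
have xi0 : 0 < xi%:C :> R[i] by rewrite ltcR.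
set G := transfer A B C D tau lam in GE *.
have -> : singular_value G xi <->
    exists2 v : 'cV_nu, v != 0 &
      map_mx Num.conj G^T *m (G *m v) = xi%:C ^+ 2 *: v.
  rewrite -(singular_pairP _ xi0); split=> [[_ //]|H].
  by split; [exact: ltW | exact: H].
rewrite GE (singular_pencilP (cmx B) (cmx C) Du Wu e1).
(* The pair of states and the initial value of the eigenfunction correspond by stacking and
   splitting. *)
split=> [[x [z [xz0 xE zE]]]|[c c0 cE]].
  exists (col_mx x z); first by rewrite col_mx_eq0 negb_and.
  apply/eq_boundary_mapP; rewrite WE !map_real_adj eC in xE zE.
  by split.
exists (usubmx c), (dsubmx c); rewrite -[c]vsubmxK in c0 cE.
move/eq_boundary_mapP: cE => [xE zE]; rewrite col_mx_eq0 negb_and in c0.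
by split; [exact: c0 | rewrite WE !map_real_adj eC; exact: xE
  | rewrite WE !map_real_adj eC; exact: zE].
Qed.
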